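(* Let $(\mathcal{M},(\cdot,\cdot))$ be a $d$-dimensional Riemannian manifold, let $\mathbf{p}\in\mathcal{M}$, let $\mathcal{X}\in\mathcal{M}^{d_1\times\cdots\times d_n}$ be a manifold-valued tensor for which $\log_{\mathbf{p}}\mathcal{X}$ is well-defined, and let $\{\Theta_{\mathbf{p}}^{j_1,\ldots,j_n,j}\}_{j_1,\ldots,j_n,j=1}^{d_1,\ldots,d_n,d}$ be a fixed orthonormal basis of $T_{\mathbf{p}}\mathcal{M}^{d_1\times\cdots\times d_n}$. Let $\kappa\in\mathbb{R}^{d_1\times\cdots\times d_n\times d}$ be any real-valued tensor with $\kappa_{j_1,\ldots,j_n,j}\le\pi^2$ for all indices, and let $\kappa_{\max}:=\max_{j_1,\ldots,j_n,j}\kappa_{j_1,\ldots,j_n,j}$. Then for any subset $\mathcal{S}\subset T_{\mathbf{p}}\mathcal{M}^{d_1\times\cdots\times d_n}$, $$\inf_{\Xi_{\mathbf{p}}\in\mathcal{S}}\Bigl\{\sum_{j_1,\ldots,j_n,j=1}^{d_1,\ldots,d_n,d}\beta(\kappa_{j_1,\ldots,j_n,j})^2\bigl(\Xi_{\mathbf{p}}-\log_{\mathbf{p}}\mathcal{X},\Theta_{\mathbf{p}}^{j_1,\ldots,j_n,j}\bigr)_{\mathbf{p}}^2\Bigr\}\;\ge\;\inf_{\Xi_{\mathbf{p}}\in\mathcal{S}}\Bigl\{\beta(\kappa_{\max})^2\|\Xi_{\mathbf{p}}-\log_{\mathbf{p}}\mathcal{X}\|_{\mathbf{p}}^2\Bi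gr\}.$$
   Context: $\mathcal{M}^{d_1\times\cdots\times d_n}$ is the space of arrays $\mathcal{X}=(\mathcal{X}_{i_1,\ldots,i_n})$, $1\le i_k\le d_k$, with entries in $\mathcal{M}$, with the product Riemannian metric. $T_{\mathbf{p}}\mathcal{M}^{d_1\times\cdots\times d_n}:=(T_{\mathbf{p}}\mathcal{M})^{d_1\times\cdots\times d_n}$ carries the product inner product $(\cdot,\cdot)_{\mathbf{p}}$ (sum of entrywise inner products) and norm $\|\cdot\|_{\mathbf{p}}$. $\log_{\mathbf{p}}$ acts entrywise; it is the inverse of $\exp_{\mathbf{p}}$ restricted to a set $\mathcal{G}'_{\mathbf{p}}\subset T_{\mathbf{p}}\mathcal{M}$ on which $\exp_{\mathbf{p}}$ is a diffeomorphism onto its image, and $\log_{\mathbf{p}}\mathcal{X}$ is well-defined when all entries of $\mathcal{X}$ lie in $\exp_{\mathbf{p}}(\mathcal{G}'_{\mathbf{p}})$. The function $\beta:\mathbb{R}\to\mathbb{R}$ is $$\beta(\kappa):=\begin{cases}\sinh(\sqrt{-\kappa})/\sqrt{-\kappa}, & \kappa<0,\\ 1, & \kappa=0,\\ \sin(\sqrt{\kappa})/\sqrt{\kappa}, & \kappa>0.\end{cases}$$ *)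

(* Defs.v *)
From HB Require Import structures.
From mathcomp Require Import all_boot all_order all_algebra.
From mathcomp Require Import all_classical all_reals all_analysis.

Set Implicit Arguments.
Unset Strict Implicit.
Unset Printing Implicit Defensive.

Import Order.TTheory GRing.Theory Num.Theory.
Import numFieldNormedType.Exports.

Local Open Scope classical_set_scope.
Local Open Scope ring_scope.

Section Smoothness.
Variables (R : realType) (m : nat) (W : normedModType R).

(* [U] is meant to be open, so that continuity at the points of [U] and partial
   derivatives on [U] only depend on the values of [f] in [U]. *)
Fixpoint Ck_on (k : nat) (U : set 'rV[R]_m) (f : 'rV[R]_m -> W) : Prop :=
  (forall x, U x -> {for x, continuous f}) /\
  if k is k'.+1 then
    forall i : 'I_m,
      (forall x, U x -> derivable f x (delta_mx 0 i)) /\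
      Ck_on k' U ('D_(delta_mx 0 i) f)
  else True.

Definition smooth_on (U : set 'rV[R]_m) (f : 'rV[R]_m -> W) : Prop :=
  forall k, Ck_on k U f.

End Smoothness.

Section Charts.
Variables (R : realType) (d : nat).

(* Homeomorphism between an open subset of [T] and an open subset of R^d; both
   functions are total, with irrelevant values outside these subsets. *)
Record chart (T : topologicalType) := Chart {
  chart_dom : set T;
  chart_img : set 'rV[R]_d;
  chart_fun : T -> 'rV[R]_d;
  chart_inv : 'rV[R]_d -> T;
  chart_dom_open : open chart_dom;
  chart_img_open : open chart_img;
  chart_funS : forall q, chart_dom q -> chart_img (chart_fun q);
  chart_invS : forall x, chart_img x -> chart_dom (chart_inv x);
  chart_funK : forall q, chart_dom q -> chart_inv (chart_fun q) = q;
  chart_invK : forall x, chart_img x -> chart_fun (chart_inv x) = x;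
  chart_fun_continuous :
    forall q, chart_dom q -> {for q, continuous chart_fun};
  chart_inv_continuous :
    forall x, chart_img x -> {for x, continuous chart_inv}
}.

Definition transition_dom (T : topologicalType) (c c' : chart T) :
  set 'rV[R]_d := chart_img c `&` chart_inv c @^-1` chart_dom c'.

Definition transition (T : topologicalType) (c c' : chart T) :
  'rV[R]_d -> 'rV[R]_d := chart_fun c' \o chart_inv c.

(* The atlas comes with a preferred chart around each point, which only serves
   to represent tangent vectors, see [tangent]. *)
Record smoothManifold := SmoothManifold {
  manifold_space :> topologicalType;
  atlas : set (chart manifold_space);
  chart_at : manifold_space -> chart manifold_space;
  manifold_hausdorff : hausdorff_space manifold_space;
  manifold_second_countable : @second_countable manifold_space;
  chart_at_atlas : forall p, atlas (chart_at p);
  chart_at_dom : forall p, chart_dom (chart_at p) p;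
  transition_smooth : forall c c', atlas c -> atlas c' ->
    smooth_on (transition_dom c c') (transition c c')
}.

(* A tangent vector at [p] is represented by its components in the preferred
   chart at [p].  The sup norm that 'rV_d carries in the library is only used
   for its topology; the Riemannian norm is given by [metric] below. *)
Definition tangent (M : smoothManifold) (p : M) : normedModType R := 'rV[R]_d.

(* The tangent vector at [q] whose components in the chart [c] are [w]. *)
Definition tangent_of_chart (M : smoothManifold) (c : chart M) (q : M)
  (w : 'rV[R]_d) : tangent q :=
  'D_w (transition c (chart_at q)) (chart_fun c q).

(* The coordinate vector field d/dx_i of the chart [c]. *)
Definition coord_field (M : smoothManifold) (c : chart M) (i : 'I_d) (q : M) :
  tangent q := tangent_of_chart c q (delta_mx 0 i).

Record riemannianManifold := RiemannianManifold {
  riemannian_manifold :> smoothManifold;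
  metric : forall p : riemannian_manifold, tangent p -> tangent p -> R;
  metric_sym : forall p (u v : tangent p), metric u v = metric v u;
  metric_linear : forall p (a : R) (u v w : tangent p),
    metric (a *: u + v) w = a * metric u w + metric v w;
  metric_pos : forall p (u : tangent p), u != 0 -> 0 < metric u u;
  metric_smooth : forall c, atlas c -> forall i j : 'I_d,
    smooth_on (chart_img c) (fun x =>
      metric (coord_field c i (chart_inv c x))
             (coord_field c j (chart_inv c x)) : R^o)
}.

End Charts.

Section Exponential.
Variables (R : realType) (d : nat) (M : riemannianManifold R d).
Implicit Types (c : chart R d M) (p q : M).

Definition gram c (x : 'rV[R]_d) : 'M[R]_d :=
  \matrix_(i, j) metric (coord_field c i (chart_inv c x))
                        (coord_field c j (chart_inv c x)).

Definition dgram c (l i j : 'I_d) (x : 'rV[R]_d) : R :=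
  'D_(delta_mx 0 l) (fun y => gram c y i j : R^o) x.

(* Christoffel symbol Gamma^k_{ij} of the Levi-Civita connection. *)
Definition christoffel c (k i j : 'I_d) (x : 'rV[R]_d) : R :=
  2^-1 * \sum_(l < d) invmx (gram c x) k l *
    (dgram c i j l x + dgram c j i l x - dgram c l i j x).

Definition geodesic_on (a b : R) (gamma : R -> M) : Prop :=
  forall t, a < t < b ->
    {for t, continuous gamma} /\
    forall c, atlas c -> chart_dom c (gamma t) ->
      let x := (chart_fun c \o gamma : R -> 'rV[R]_d) in
      [/\ derivable x t 1, derivable (derive1 x) t 1 &
          forall k : 'I_d,
            derive1 (derive1 x) t ord0 k +
            \sum_(i < d) \sum_(j < d) christoffel c k i j (x t) *
              derive1 x t ord0 i * derive1 x t ord0 j = 0].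

(* [q] is the value at time 1 of a geodesic issued from [p] with velocity [v];
   the velocity of a curve at [p] is read in the preferred chart at [p]. *)
Definition exp_graph p (v : tangent p) (q : M) : Prop :=
  exists (a b : R) (gamma : R -> M),
    [/\ a < 0 /\ 1 < b, geodesic_on a b gamma, gamma 0 = p,
        derive1 (chart_fun (chart_at p) \o gamma : R -> 'rV[R]_d) 0 = v
      & gamma 1 = q].

Definition exp_dom p : set (tangent p) :=
  [set v | exists q, exp_graph v q].

(* Irrelevant value [p] outside [exp_dom p]. *)
Definition rexp p (v : tangent p) : M := xget p (exp_graph v).

(* [G] need not be open, so smoothness of [rexp] on [G] and of its inverse on
   the image of [G] means existence of local smooth extensions in charts; this
   is ordinary smoothness when these sets are open. *)
Definition rexp_smooth_on p (G : set (tangent p)) : Prop :=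
  forall v, G v -> forall c, atlas c -> chart_dom c (rexp v) ->
    exists (U : set 'rV[R]_d) (F : 'rV[R]_d -> 'rV[R]_d),
      [/\ open U, U v, smooth_on U F &
          forall w : tangent p, G w -> U w ->
            chart_dom c (rexp w) /\ F w = chart_fun c (rexp w)].

(* Inverse of [rexp] restricted to [G], with value 0 outside [rexp @` G]. *)
Definition rlog p (G : set (tangent p)) : M -> tangent p :=
  'pinv_(fun=> 0) G (@rexp p).

Definition rlog_smooth_on p (G : set (tangent p)) : Prop :=
  forall q, (@rexp p @` G) q -> forall c, atlas c -> chart_dom c q ->
    exists (U : set 'rV[R]_d) (F : 'rV[R]_d -> 'rV[R]_d),
      [/\ open U, U (chart_fun c q), smooth_on U F &
          forall r : M, (@rexp p @` G) r -> chart_dom c r ->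
            U (chart_fun c r) -> F (chart_fun c r) = rlog G r].

Definition rexp_diffeo_on p (G : set (tangent p)) : Prop :=
  [/\ G `<=` @exp_dom p, {in G &, injective (@rexp p)},
      rexp_smooth_on G & rlog_smooth_on G].

End Exponential.

Section Tensors.
Variables (n : nat) (dims : 'I_n -> nat).

Definition multi_index : finType := {dffun forall k : 'I_n, 'I_(dims k)}.

Definition tensor (T : Type) := {ffun multi_index -> T}.

End Tensors.

Section TangentTensors.
Variables (R : realType) (d : nat) (M : riemannianManifold R d) (p : M).
Variables (n : nat) (dims : 'I_n -> nat).

(* T_p M^(d_1 x ... x d_n). *)
Definition tangent_tensor : lmodType R := tensor dims (tangent p).

Definition tensor_log (G : set (tangent p)) (X : tensor dims M) :
  tangent_tensor := [ffun J => rlog G (X J)].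

Definition tensor_inner (U V : tangent_tensor) : R :=
  \sum_(J : multi_index dims) metric (U J) (V J).

Definition tensor_norm (U : tangent_tensor) : R := Num.sqrt (tensor_inner U U).

Definition orthonormal_basis
    (Theta : multi_index dims -> 'I_d -> tangent_tensor) : Prop :=
  (forall J j J' j',
     tensor_inner (Theta J j) (Theta J' j') = ((J == J') && (j == j'))%:R) /\
  (forall V : tangent_tensor, exists a : multi_index dims -> 'I_d -> R,
     V = \sum_J \sum_j a J j *: Theta J j).

End TangentTensors.

Section Beta.
Variable R : realType.

Definition sinh (x : R) : R := (expR x - expR (- x)) / 2.

Definition beta (kappa : R) : R :=
  if kappa < 0 then sinh (Num.sqrt (- kappa)) / Num.sqrt (- kappa)
  else if kappa == 0 then 1
  else sin (Num.sqrt kappa) / Num.sqrt kappa.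

End Beta.

(* Main.v *)
Require Import Defs.
From mathcomp Require Import all_boot all_order all_algebra.
From mathcomp Require Import all_classical all_reals all_analysis.
From mathcomp Require Import ring lra.

(* The coefficients of V in an orthonormal basis are its inner products with the
   basis vectors, so Parseval's identity turns the right-hand functional into the
   left-hand one with every beta (kappa J j) replaced by beta kappa_max.  It
   remains to see that beta is nonnegative and nonincreasing on ]-oo, pi^2].
   Both branches are slopes f x / x of functions with f 0 = 0: such a slope is
   nonincreasing where f' is, which applies to sin on [0, pi] and to - sinh on
   [0, +oo[; for kappa < 0 the order is reversed twice, as sqrt (- kappa) is
   nonincreasing in kappa.  The value 1 at kappa = 0 is the derivative of both
   functions sin and sinh at 0, hence bounds their slopes. *)

Import Order.TTheory GRing.Theory Num.Theory.
Import numFieldNormedType.Exports.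

Local Open Scope classical_set_scope.
Local Open Scope ring_scope.

Section Slope.
Variables (R : realType) (f df : R -> R) (b : R).
Hypothesis f0 : f 0 = 0.
Hypothesis f_derive : forall x : R, is_derive x 1 f (df x).
Hypothesis df_noninc : forall x y : R, 0 <= x -> x <= y -> y <= b -> df y <= df x.

Lemma mean_value (x y : R) : x < y ->
  exists2 c, x < c < y & f y - f x = df c * (y - x).
Proof.
move=> xy; have f_cont : {within `[x, y], continuous f}.
  by apply: derivable_within_continuous => z _; exact: ex_derive.
have [c] := MVT xy (fun z _ => f_derive z) f_cont.
by rewrite in_itv /= => cxy E; exists c.
Qed.

Lemma slope_le_derive0 (x : R) : 0 < x -> x <= b -> f x / x <= df 0.
Proof.
move=> x0 xb; have [c /andP[c0 cx]] := mean_value _ _ x0.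
rewrite f0 !subr0 => ->; rewrite mulfK ?gt_eqF //.
by apply: df_noninc => //; lra.
Qed.

(** The mean value theorem on [[0, x]] and on [[x, y]] gives points [c < x < e] where [df] equals
    the slopes of the two successive chords; since [df e <= df c], the chord from 0 flattens when
    extended from [x] to [y]. *)
Lemma slope_noninc (x y : R) : 0 < x -> x <= y -> y <= b -> f y / y <= f x / x.
Proof.
move=> x0; rewrite le_eqVlt => /predU1P[->//|xy] yb.
have [c /andP[c0 cx]] := mean_value _ _ x0; have [e /andP[xe ey]] := mean_value _ _ xy.
rewrite f0 !subr0 => fy fx; have y0 : 0 < y by lra.
have ce : df e <= df c by apply: df_noninc; lra.
rewrite ler_pdivrMr // mulrAC ler_pdivlMr //.
have -> : f y = f x + df e * (y - x) by rewrite -fy; ring.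
rewrite fx -subr_ge0.
(* With denominators cleared, the gap between the two sides factors into nonnegative terms. *)
have -> : df c * x * y - (df c * x + df e * (y - x)) * x =
  (df c - df e) * (x * (y - x)) by ring.
by rewrite !mulr_ge0 ?subr_ge0 ?(ltW x0) ?(ltW xy).
Qed.

End Slope.

Section BetaMonotone.
Variable R : realType.
Implicit Types x y k l : R.

Definition cosh (x : R) : R := (expR x + expR (- x)) / 2.

Lemma sinh0 : sinh 0 = 0 :> R.
Proof. by rewrite /sinh oppr0 subrr mul0r. Qed.

Lemma cosh0 : cosh 0 = 1.
Proof. by rewrite /cosh oppr0 expR0; lra. Qed.

(** The sign is flipped because the slope lemmas ask for a nonincreasing derivative, and [- cosh] is
    one on [[0, +oo[]. *)
Lemma is_derive_sinhN x : is_derive x 1 (fun t => - sinh t) (- cosh x).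
Proof.
rewrite /sinh /cosh; apply: is_derive_eq.
by rewrite !scaler0 add0r -[_ *: _]/(_ * _); field.
Qed.

(** With [u = expR x] and [v = expR y], both at least 1, the loss [u^-1 - v^-1 = (v - u) / (u v)] is
    at most the gain [v - u]. *)
Lemma cosh_ndecr x y : 0 <= x -> x <= y -> cosh x <= cosh y.
Proof.
move=> x0 xy; rewrite /cosh !expRN.
have u1 : 1 <= expR x by rewrite -expR0 ler_expR.
have uv : expR x <= expR y by rewrite ler_expR.
move: (expR x) (expR y) u1 uv => u v u1 uv.
have iu : u^-1 <= 1 by rewrite invf_le1 //; lra.
have iv : v^-1 <= 1 by rewrite invf_le1 //; lra.
have iu0 : 0 <= u^-1 by rewrite invr_ge0; lra.
have iv0 : 0 <= v^-1 by rewrite invr_ge0; lra.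
have uvV : u^-1 - v^-1 = (v - u) * (u^-1 * v^-1).
  by field; apply/andP; split; apply/eqP => ?; lra.
suff : u^-1 - v^-1 <= v - u by lra.
by rewrite uvV ler_piMr ?subr_ge0 // mulr_ile1.
Qed.

Lemma sinh_slope_ndecr x y : 0 < x -> x <= y -> sinh x / x <= sinh y / y.
Proof.
move=> x0 xy; rewrite -lerN2 -[- (sinh y / y)]mulNr -[- (sinh x / x)]mulNr.
apply: (@slope_noninc _ (fun t => - sinh t) (fun t => - cosh t) y) => //.
- by rewrite sinh0 oppr0.
- exact: is_derive_sinhN.
- by move=> s t s0 st _; rewrite lerN2 cosh_ndecr.
Qed.

Lemma sinh_slope_ge1 x : 0 < x -> 1 <= sinh x / x.
Proof.
move=> x0; rewrite -lerN2 -[- (sinh x / x)]mulNr -cosh0.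
apply: (@slope_le_derive0 _ (fun t => - sinh t) (fun t => - cosh t) x) => //.
- by rewrite sinh0 oppr0.
- exact: is_derive_sinhN.
- by move=> s t s0 st _; rewrite lerN2 cosh_ndecr.
Qed.

Lemma cos_noninc x y : 0 <= x -> x <= y -> y <= pi -> cos y <= cos x.
Proof.
move=> x0 xy ypi; rewrite leNgt ltr_cos -?leNgt // in_itv /=.
  by rewrite ypi (le_trans x0).
by rewrite x0 (le_trans xy).
Qed.

Lemma sin_slope_noninc x y :
  0 < x -> x <= y -> y <= pi -> sin y / y <= sin x / x.
Proof.
apply: (@slope_noninc _ sin cos pi); first exact: sin0.
exact: cos_noninc.
Qed.

Lemma sin_slope_le1 x : 0 < x -> x <= pi -> sin x / x <= 1.
Proof.
move=> x0 xpi; rewrite -[leRHS]cos0; apply: (@slope_le_derive0 _ sin cos pi) => //.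
- exact: sin0.
- exact: cos_noninc.
Qed.

Lemma sqrt_le_pi k : k <= pi ^+ 2 -> Num.sqrt k <= pi.
Proof. by move=> /ler_wsqrtr; rewrite sqrtr_sqr ger0_norm ?pi_ge0. Qed.

(** The bound [pi ^+ 2] keeps [Num.sqrt k] in [[0, pi]], where [sin] is nonnegative. *)
Lemma beta_ge0 k : k <= pi ^+ 2 -> 0 <= beta k.
Proof.
move=> kpi; rewrite /beta; case: ltgtP => // k0.
  rewrite (le_trans ler01) // sinh_slope_ge1 // sqrtr_gt0; lra.
by rewrite divr_ge0 ?sqrtr_ge0 // sin_ge0_pi // sqrtr_ge0 sqrt_le_pi.
Qed.

Lemma beta_noninc k l : k <= l -> l <= pi ^+ 2 -> beta l <= beta k.
Proof.
move=> kl lpi; rewrite /beta.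
(* Apart from [k = l = 0], five sign patterns are compatible with [k <= l]; the others are
   contradictory. *)
case: (ltgtP k 0) => k0; case: (ltgtP l 0) => l0 //; try lra.
- by rewrite sinh_slope_ndecr ?sqrtr_gt0 ?ler_wsqrtr //; lra.
(* For [k < 0 < l], the value 1 separates the two branches. *)
- rewrite (@le_trans _ _ 1) ?sinh_slope_ge1 ?sin_slope_le1 ?sqrt_le_pi ?sqrtr_gt0 //.
  lra.
- by rewrite sinh_slope_ge1 // sqrtr_gt0; lra.
- by rewrite sin_slope_noninc ?sqrtr_gt0 ?ler_wsqrtr ?sqrt_le_pi.
- by rewrite sin_slope_le1 ?sqrtr_gt0 ?sqrt_le_pi.
Qed.

End BetaMonotone.

Section Parseval.
Variables (R : realType) (d : nat) (M : riemannianManifold R d) (p : M).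
Variables (n : nat) (dims : 'I_n -> nat).
Implicit Types U V W : tangent_tensor p dims.

Lemma tensor_innerC U V : tensor_inner U V = tensor_inner V U.
Proof. by apply: eq_bigr => J _; exact: Defs.metric_sym. Qed.

Lemma tensor_inner_linear (a : R) U V W :
  tensor_inner (a *: U + V) W = a * tensor_inner U W + tensor_inner V W.
Proof.
rewrite /tensor_inner mulr_sumr -big_split; apply: eq_bigr => J _ /=.
by rewrite !ffunE metric_linear.
Qed.

Lemma tensor_innerD U V W :
  tensor_inner (U + V) W = tensor_inner U W + tensor_inner V W.
Proof. by rewrite -[U]scale1r tensor_inner_linear mul1r scale1r. Qed.

Lemma tensor_inner0 W : tensor_inner 0 W = 0.
Proof.
by apply: (@addrI _ (tensor_inner 0 W)); rewrite -tensor_innerD !addr0.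
Qed.

Lemma tensor_innerZ (a : R) U W :
  tensor_inner (a *: U) W = a * tensor_inner U W.
Proof. by rewrite -[a *: U]addr0 tensor_inner_linear tensor_inner0 addr0. Qed.

Lemma tensor_inner_suml (I : finType) (F : I -> tangent_tensor p dims) W :
  tensor_inner (\sum_i F i) W = \sum_i tensor_inner (F i) W.
Proof.
apply: (big_morph (fun U => tensor_inner U W)) => [U V|].
  exact: tensor_innerD.
exact: tensor_inner0.
Qed.

Lemma tensor_inner_ge0 U : 0 <= tensor_inner U U.
Proof.
apply: sumr_ge0 => J _; have [->|/metric_pos/ltW//] := eqVneq (U J) 0.
(* [metric_pos] only covers nonzero vectors; linearity at [1 *: 0 + 0] gives
   [metric 0 0 = metric 0 0 + metric 0 0], so this value is 0. *)
have := metric_linear 1 (0 : tangent p) 0 0.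
by rewrite scaler0 addr0 mul1r => /eqP; rewrite addrC -subr_eq subrr => /eqP <-.
Qed.

Lemma parseval (Theta : multi_index dims -> 'I_d -> tangent_tensor p dims) V :
  orthonormal_basis Theta ->
  tensor_norm V ^+ 2 = \sum_J \sum_j tensor_inner V (Theta J j) ^+ 2.
Proof.
case=> ortho /(_ V)[a Va].
have coef J j : tensor_inner V (Theta J j) = a J j.
  (* By orthonormality only the term of index [(J, j)] survives in the expansion of [V]. *)
  rewrite Va tensor_inner_suml (bigD1 J) //= addrC big1 => [|J' /negPf J'J].
    rewrite add0r tensor_inner_suml (bigD1 j) //= big1 => [|j' /negPf j'j].
      by rewrite addr0 tensor_innerZ ortho !eqxx mulr1.
    by rewrite tensor_innerZ ortho j'j andbF mulr0.
  by rewrite tensor_inner_suml big1 // => j' _; rewrite tensor_innerZ ortho J'J mulr0.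
(* Only the left factor is expanded, so that [coef] identifies what remains of the right one. *)
rewrite sqr_sqrtr ?tensor_inner_ge0 // {1}Va tensor_inner_suml.
apply: eq_bigr => J _; rewrite tensor_inner_suml; apply: eq_bigr => j _.
by rewrite tensor_innerZ tensor_innerC coef expr2.
Qed.

End Parseval.

Theorem corollary4p2 (R : realType) (d : nat) (M : riemannianManifold R d)
  (p : M) (G : set (tangent p)) (hG : rexp_diffeo_on G)
  (n : nat) (dims : 'I_n -> nat)
  (X : tensor dims M) (hX : forall J, (@rexp R d M p @` G) (X J))
  (Theta : multi_index dims -> 'I_d -> tangent_tensor p dims)
  (hTheta : orthonormal_basis Theta)
  (kappa : multi_index dims -> 'I_d -> R)
  (hkappa : forall J j, kappa J j <= pi ^+ 2)
  (kappa_max : R)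
  (hmax : (exists J j, kappa J j = kappa_max) /\
          (forall J j, kappa J j <= kappa_max))
  (S : set (tangent_tensor p dims)) :
  (ereal_inf [set (\sum_(J : multi_index dims) \sum_(j < d)
       beta (kappa J j) ^+ 2 *
       tensor_inner (Xi - tensor_log G X) (Theta J j) ^+ 2)%:E | Xi in S]
   >= ereal_inf [set (beta kappa_max ^+ 2 *
       tensor_norm (Xi - tensor_log G X) ^+ 2)%:E | Xi in S])%E.
Proof.
apply: le_ereal_inf_tmp => _ [Xi SXi <-].
(* The two functionals are compared at the same [Xi], whose value on the smaller side bounds that
   infimum from above. *)
apply: (@le_trans _ _ (beta kappa_max ^+ 2 *
  tensor_norm (Xi - tensor_log G X) ^+ 2)%:E); first by apply: ereal_inf_lbound; exists Xi.
have [[J0 [j0 kmax]] kle] := hmax.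
(* The maximum is attained, so it inherits the bound on the entries. *)
have kmax_pi : kappa_max <= pi ^+ 2 by rewrite -kmax.
rewrite lee_fin (parseval _ _ _ _ _ _ _ _ hTheta) mulr_sumr ler_sum // => J _.
rewrite mulr_sumr ler_sum // => j _; apply: ler_wpM2r; first exact: sqr_ge0.
by rewrite ler_sqr ?nnegrE ?beta_ge0 ?beta_noninc.
Qed.
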